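(* Let $G$ be a finite $P$-group. Then $G$ is a $\mathcal{B}_{\psi}$-group if and only if $G$ is elementary abelian.
   Context: For a finite group $H$, let $\psi(H)=\sum_{x\in H}o(x)$ be the sum of the orders of all elements of $H$, where $o(x)$ is the order of $x$. A finite group $G$ is called a $\mathcal{B}_{\psi}$-group if $\psi(H)<|G|$ for every proper subgroup $H$ of $G$. Let $p$ be a prime and $n\geq 2$ an integer. A finite group $G$ belongs to the class $P(n,p)$ if $G$ is either an elementary abelian $p$-group of order $p^n$, or a semidirect product of an elementary abelian normal $p$-subgroup $H$ of order $p^{n-1}$ by a group of prime order $q\neq p$ which induces a non-trivial power automorphism on $H$ (a power automorphism of $H$ is an automorphism mapping every subgroup of $H$ to itself). $G$ is called a $P$-group if $G$ belongs to $P(n,p)$ for some prime $p$ and some integer $n\geq 2$. *)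

(* Defs.v *)
From mathcomp Require Import all_boot all_fingroup all_solvable.

Set Implicit Arguments.
Unset Strict Implicit.
Unset Printing Implicit Defensive.

Local Open Scope group_scope.

Definition psi (gT : finGroupType) (H : {set gT}) : nat := \sum_(x in H) #[x].

Definition Bpsi_group (gT : finGroupType) (G : {group gT}) : Prop :=
  forall H : {group gT}, H \proper G -> psi H < #|G|.

Definition power_automorphism (gT : finGroupType) (H : {group gT})
    (a : {perm gT}) : Prop :=
  a \in Aut H /\ forall L : {group gT}, L \subset H -> a @: L = L.

(* The semidirect product is internal; conj_aut H x is the automorphism of H
   that x \in 'N(H) induces by conjugation. *)
Definition P_class (n p : nat) (gT : finGroupType) (G : {group gT}) : Prop :=
  (p.-abelem G /\ #|G| = (p ^ n)%N) \/
  exists (q : nat) (H K : {group gT}),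
    [/\ prime q /\ q != p,
        H ><| K = G,
        p.-abelem H /\ #|H| = (p ^ n.-1)%N,
        #|K| = q
      & (forall x, x \in K -> power_automorphism H (conj_aut H x)) /\
        (exists2 x, x \in K & conj_aut H x != 1)].

Definition P_group (gT : finGroupType) (G : {group gT}) : Prop :=
  exists n p : nat, [/\ prime p, 2 <= n & P_class n p G].

(* Main.v *)
(** In an elementary abelian [p]-group every non-trivial element has order [p],
    so [psi H = 1 + p * (#|H| - 1)]; a proper subgroup [H] of [G] has
    [p * #|H| <= #|G|].  Conversely, in a semidirect product [H ><| K] in
    [P(n, p)], an element [h] of [H] moved by [K] has [q = #|K|] conjugates
    under [K], all of them non-trivial elements of [<[h]>].  Hence [q < p], and
    then [psi H >= p ^ n.-1 * (p - 1) >= #|G|] for the proper subgroup [H]. *)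
Require Import Defs.
From mathcomp Require Import all_boot all_fingroup all_solvable.

Set Implicit Arguments.
Unset Strict Implicit.
Unset Printing Implicit Defensive.

Local Open Scope group_scope.

Lemma psi_abelem (gT : finGroupType) (p : nat) (H : {group gT}) :
  p.-abelem H -> psi H = (#|H|.-1 * p).+1.
Proof.
move=> abH; rewrite /psi (big_setD1 1) //= order1 add1n.
rewrite (eq_bigr (fun=> p)) => [|x]; last first.
  by rewrite 2!inE => /andP[ntx Hx]; apply: abelem_order_p abH Hx ntx.
by rewrite sum_nat_const (cardsD1 1 H) group1.
Qed.

Lemma abelem_Bpsi_group (gT : finGroupType) (p : nat) (G : {group gT}) :
  prime p -> p.-abelem G -> Bpsi_group G.
Proof.
move=> p_pr abG H ltHG; have sHG := proper_sub ltHG.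
have abH := abelemS sHG abG.
have iGH_gt0 : 1 < #|G : H| by rewrite indexg_gt1 proper_subn.
have p_dv_i : p %| #|G : H|.
  have /p_natP[[|k] Dk] := pnat_dvd (dvdn_indexg G H) (abelem_pgroup abG).
    by rewrite Dk in iGH_gt0.
  by rewrite Dk expnS dvdn_mulr.
rewrite (psi_abelem abH) -(Lagrange sHG).
(* The index is a non-trivial power of [p], hence at least [p]. What remains,
   [1 + (#|H| - 1) * p < #|H| * p], amounts to [1 < p]. *)
apply: leq_trans (leq_mul (leqnn _) (dvdn_leq (ltnW iGH_gt0) p_dv_i)).
by rewrite -{2}(prednK (cardG_gt0 H)) mulSn addnC -addn2 leq_add2l prime_gt1.
Qed.

Lemma power_automorphism_order_lt (gT : finGroupType) (p : nat)
    (H K : {group gT}) :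
    p.-abelem H -> K \subset 'N(H) -> prime #|K| ->
    (forall x, x \in K -> power_automorphism H (conj_aut H x)) ->
    (exists2 x, x \in K & conj_aut H x != 1) ->
  #|K| < p.
Proof.
move=> abH nHK K_pr powK [x Kx ntx].
(* Elements of [Aut H] that agree on [H] are equal, so a non-trivial one moves a point of [H]. *)
have [h Hh nfix_h] : exists2 h, h \in H & h ^ x != h.
  apply/exists_inP; apply: contraR ntx => /exists_inPn fixH; apply/eqP.
  have [Aut_x _] := powK x Kx; apply: (eq_Aut Aut_x (group1 _)) => h Hh.
  rewrite perm1 norm_conj_autE ?(subsetP nHK) //.
  by apply/eqP; rewrite -[_ == _]negbK fixH.
have nt_h : h != 1 by apply: contraNneq nfix_h => ->; rewrite conj1g.
(* As [#|K|] is prime, the stabiliser of [h] is trivial once it omits [x]; the orbit of [h] then has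
   exactly [#|K|] elements. *)
have ntC : 'C_K[h] = 1.
  apply: (prime_TIg K_pr); apply: contra nfix_h => /subsetP/(_ x Kx) /cent1P chx.
  by rewrite conjgE -chx mulKg.
have sub_class : h ^: K \subset <[h]>^#.
  apply/subsetP=> _ /imsetP[y Ky ->]; rewrite !inE conjg_eq1 nt_h /=.
  have [_ /(_ <[h]>%G)] := powK y Ky; rewrite cycle_subG => /(_ Hh) <-.
  apply/imsetP; exists h; first exact: cycle_id.
  by rewrite norm_conj_autE ?(subsetP nHK).
have := subset_leq_card sub_class.
rewrite -index_cent1 ntC indexg1 => leK.
rewrite -(abelem_order_p abH Hh nt_h) /order.
by rewrite (cardsD1 1 <[h]>) group1.
Qed.

Theorem corollary2p6 (gT : finGroupType) (G : {group gT}) :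
  P_group G -> (Bpsi_group G <-> is_abelem G).
Proof.
move=> [n [p [p_pr n_gt1 PnG]]]; split=> [BG | /is_abelemP[r r_pr abG]]; last first.
  exact: abelem_Bpsi_group r_pr abG.
case: PnG => [[abG _] | [q [H [K [[q_pr _] defG [abH oH] oK [powK ntK]]]]]].
  by apply/is_abelemP; exists p.
have [_ _ nHK _] := sdprodP defG.
have oG := sdprod_card defG.
have q_lt_p : q < p.
  by rewrite -oK; apply: power_automorphism_order_lt powK ntK; rewrite ?oK.
have sHG : H \subset G by have [/andP[]] := sdprod_context defG.
have ltHG : H \proper G.
  by rewrite properEcard sHG -oG oK ltn_Pmulr ?prime_gt1.
have p_le_H : p <= #|H|.
  rewrite oH -{1}[p]expn1; apply: leq_pexp2l; first exact: prime_gt0.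
  by case: (n) n_gt1.
have := BG H ltHG; rewrite (psi_abelem abH) -oG oK ltnNge => /negP[].
(* With [q <= p - 1] and [p <= #|H|]: [#|H| * q <= #|H| * p - #|H| <= #|H| * p - p = (#|H| - 1) *
   p]. *)
apply: (@leq_trans (#|H| * p.-1)).
  by rewrite leq_mul2l -ltnS prednK ?q_lt_p ?orbT ?prime_gt0.
apply: leqW; rewrite -!subn1 mulnBr mulnBl muln1 mul1n.
exact: leq_sub2l.
Qed.
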